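(* Let $n=2^k m$ or $n=p^k$, where $k$ and $m$ are positive integers, $m>1$ is odd, and $p$ is an odd prime. Then the unitary Cayley graph $U_n$ has a total coloring with $\Delta+1=\phi(n)+1$ colors, where $\Delta$ is its maximum degree.
   Context: A total coloring of a simple graph $G$ is an assignment of colors to its vertices and edges such that adjacent vertices receive different colors, adjacent edges (edges sharing an endpoint) receive different colors, and each edge receives a color different from both of its endpoints. The unitary Cayley graph $U_n$ is the graph with vertex set $\mathbb{Z}_n=\{0,1,\dots,n-1\}$ in which $x$ and $y$ are adjacent iff $\gcd(x-y,n)=1$ (equivalently, the Cayley graph of $\mathbb{Z}_n$ with connection set $\{i: 1\le i<n,\ \gcd(i,n)=1\}$); it is $\phi(n)$-regular, where $\phi$ is Euler's totient function. *)

(* Defs.v *)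
From mathcomp Require Import all_boot all_order all_algebra.

Set Implicit Arguments.
Unset Strict Implicit.
Unset Printing Implicit Defensive.

Import GRing.Theory.

(* A finite simple graph is a symmetric irreflexive relation on a finType;
   its edges are the two-element sets of adjacent vertices. *)
Section Graph.
Variables (T : finType) (e : rel T).

Definition edges : {set {set T}} :=
  [set A | [exists x, exists y, e x y && (A == [set x; y])]].

Definition degree (x : T) : nat := #|[set y | e x y]|.

Definition max_degree : nat := \max_(x : T) degree x.

(* The values of ce on sets that are not edges are irrelevant. *)
Definition is_total_coloring (C : Type) (cv : T -> C) (ce : {set T} -> C) : Prop :=
  [/\ forall x y : T, e x y -> cv x <> cv y,
      forall A B : {set T}, A \in edges -> B \in edges -> A != B ->
        A :&: B != set0 -> ce A <> ce B
    & forall (A : {set T}) (x : T), A \in edges -> x \in A -> ce A <> cv x].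

Definition total_colorable (k : nat) : Prop :=
  exists (cv : T -> 'I_k) (ce : {set T} -> 'I_k), is_total_coloring cv ce.

End Graph.

(* x - y is taken in int, so that it is not truncated. *)
Definition unitary_cayley (n : nat) : rel 'I_n :=
  fun x y => coprimez (x%:Z - y%:Z)%R n%:Z.

Lemma unitary_cayley_sym n : symmetric (@unitary_cayley n).
Proof. by move=> x y; rewrite /unitary_cayley -coprimeNz opprB. Qed.

(* For n = 1 the relation would have a loop at 0. *)
Lemma unitary_cayley_irrefl n : 1 < n -> irreflexive (@unitary_cayley n).
Proof.
move=> n_gt1 x; rewrite /unitary_cayley subrr /coprimez gcd0z /=.
by case: n n_gt1 x => [|[|n]].
Qed.

(* Main.v *)
Require Import Defs.
From mathcomp Require Import all_boot all_order all_algebra.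
From mathcomp Require Import zify.

(** The colors are arranged in a symmetric array indexed by pairs of vertices,
    the diagonal holding the vertex colors; the coloring is total as soon as
    each row is injective on closed neighborhoods and adjacent vertices differ
    on the diagonal.

    For [n = p ^ k], the graph is complete [p]-partite with parts of size
    [q = p ^ (k - 1)].  One part is colored with a single color [*]; the other
    vertices form [Z_N] with [N = (p - 1) q = 2 h], the parts being the residue
    classes mod [p - 1], and the edge [{x, x + d}] is colored [x + delta d], or
    [*] if [d = h].  Here [delta] is a permutation of [0, N) fixing [0] with
    [delta d = d + delta (- d)] for [d <> h].  The values of [delta] at [h] and
    at the nonzero multiples of [p - 1], which are not needed inside [Z_N], are
    exactly [q] in number and serve for the edges to the distinguished part.

    For [n = 2 ^ k m], let [p] be the least prime factor of [m].  The graph is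
    bipartite, and its edges are [{x, x + m + 2 i}] with [x] even and [i] prime
    to [m].  The edges with [i >= p] get color [i]; those with [0 < i < p],
    together with the vertices [x] and [x + m] (the case [i = 0]), get color
    [x + i] mod [p]. *)

(** * Total colorings from symmetric arrays and along injective homomorphisms *)

Section Array.
Variables (T : finType) (e : rel T).
Hypotheses (e_sym : symmetric e) (e_irr : irreflexive e).

Lemma edge_at (A : {set T}) (x : T) :
  A \in edges e -> x \in A -> exists2 y, e x y & A = [set x; y].
Proof.
rewrite inE => /existsP[a /existsP[b /andP[eab /eqP->]]].
rewrite !inE => /orP[]/eqP->; first by exists b.
by exists a; rewrite 1?e_sym // setUC.
Qed.

Variables (C : eqType) (col : T -> T -> C).

(** An edge has no orientation, so one is picked; symmetry of [col] makes the choice irrelevant, and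
    [c0] only serves sets that are not edges. *)
Definition array_edge_color (c0 : C) (A : {set T}) : C :=
  if [pick u : T * T | e u.1 u.2 && (A == [set u.1; u.2])] is Some u
  then col u.1 u.2 else c0.

Lemma array_edge_colorE (c0 : C) (x y : T) :
  (forall x y, e x y -> col x y = col y x) -> e x y ->
  array_edge_color c0 [set x; y] = col x y.
Proof.
move=> col_sym exy; rewrite /array_edge_color; case: pickP => [[a b] /=|]; last first.
  by move/(_ (x, y)); rewrite /= exy eqxx.
case/andP=> eab /eqP Exy.
have: x \in [set a; b] by rewrite -Exy !inE eqxx.
have: y \in [set a; b] by rewrite -Exy !inE eqxx orbT.
rewrite !inE => /orP[]/eqP Ey /orP[]/eqP Ex; subst => //.
- by rewrite e_irr in exy.
- by rewrite col_sym.
- by rewrite e_irr in exy.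
Qed.

(** The entry at [(x, x)] is the color of [x], so injectivity of row [x] excludes edge-edge and
    vertex-edge conflicts at [x] at once. Colors are renumbered by their index in [s], so any short
    enough list can be the palette. *)
Lemma total_colorable_of_array (s : seq C) (k : nat) :
    (forall x y, e x y -> col x y = col y x) ->
    (forall x y z, (x == y) || e x y -> (x == z) || e x z ->
       col x y = col x z -> y = z) ->
    (forall x y, e x y -> col x x <> col y y) ->
    (forall x y, (x == y) || e x y -> col x y \in s) ->
    size s <= k.+1 -> total_colorable e k.+1.
Proof.
move=> col_sym col_inj col_proper col_s le_s_k.
pose rk c : 'I_k.+1 := inord (index c s).
have rk_inj c c' : c \in s -> c' \in s -> rk c = rk c' -> c = c'.
  move=> cs c's /(congr1 (@nat_of_ord _)); rewrite !inordK ?(leq_trans _ le_s_k) ?index_mem //.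
  exact: index_inj.
(* A vertex [x0] supplies the default color; without vertices every condition is vacuous. *)
case: (pickP (mem T)) => [x0 _|T0]; last first.
  by exists (fun=> ord0), (fun=> ord0); split=> [x|A B|A x]; last 2 first;
    [rewrite inE => /existsP[x]; have := T0 x | have := T0 x | have := T0 x].
pose ce A := array_edge_color (col x0 x0) A.
exists (fun x => rk (col x x)), (fun A => rk (ce A)); split.
- by move=> x y exy /rk_inj E; apply: (col_proper x y exy); apply: E;
    apply: col_s; rewrite eqxx.
- move=> A B eA eB nAB /set0Pn[x]; rewrite inE => /andP[xA xB].
  have [y exy EA] := edge_at _ _ eA xA; have [z exz EB] := edge_at _ _ eB xB.
  rewrite /ce EA EB !array_edge_colorE // => /rk_inj E.
  suff yz : y = z by rewrite EA EB yz eqxx in nAB.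
  by apply: (col_inj x); rewrite ?exy ?exz ?orbT //; apply: E; apply: col_s;
    rewrite ?exy ?exz orbT.
- move=> A x eA xA; have [y exy EA] := edge_at _ _ eA xA.
  rewrite /ce EA array_edge_colorE // => /rk_inj E.
  suff yx : y = x by rewrite yx e_irr in exy.
  by apply: (col_inj x); rewrite ?exy ?eqxx ?orbT //; apply: E; apply: col_s;
    rewrite ?exy ?eqxx ?orbT.
Qed.
End Array.

(** A conflict in [e] maps to a conflict in [e'], injectivity of [f] keeping distinct edges
    distinct. *)
Lemma total_colorable_pullback (T V : finType) (e : rel T) (e' : rel V)
    (f : T -> V) (k : nat) :
  injective f -> (forall x y, e x y -> e' (f x) (f y)) ->
  total_colorable e' k -> total_colorable e k.
Proof.
move=> f_inj f_hom [cv [ce [vP eP veP]]].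
have f_edge A : A \in edges e -> f @: A \in edges e'.
  rewrite !inE => /existsP[x /existsP[y /andP[exy /eqP->]]].
  apply/existsP; exists (f x); apply/existsP; exists (f y).
  by rewrite f_hom // imsetU !imset_set1 eqxx.
exists (cv \o f), (fun A : {set T} => ce (f @: A)); split.
- by move=> x y /f_hom/vP.
- move=> A B eA eB nAB /set0Pn[x]; rewrite inE => /andP[xA xB].
  apply: eP; rewrite ?f_edge ?(inj_eq (imset_inj f_inj)) //.
  by apply/set0Pn; exists (f x); rewrite inE !imset_f.
- by move=> A x eA xA; apply: veP; rewrite ?f_edge ?imset_f.
Qed.

(** * Total coloring of complete multipartite graphs *)

(* The halves [d./2] for even [d < h] and odd [d > h] fill [0, h), the other
   ones fill [h, 2h) after a shift by [h], except for one gap: the value at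
   [d = h] is chosen to be that gap. *)
Definition delta (h d : nat) : nat := d./2 + h * ((d == h) || (odd d (+) (h < d))).

Lemma delta_lt (h d : nat) : d < h.*2 -> delta h d < h.*2.
Proof. rewrite /delta; case: (_ || _); lia. Qed.

Lemma delta_inj (h d d' : nat) :
  d < h.*2 -> d' < h.*2 -> delta h d = delta h d' -> d = d'.
Proof.
rewrite /delta => lt_d lt_d'.
have := odd_double_half d; have := odd_double_half d'.
by case: (odd d); case: (odd d'); case: (ltngtP d h) => /=; case: (ltngtP d' h) => /=; lia.
Qed.

Definition sub_mod (N y x : nat) := if x <= y then y - x else y + N - x.

Lemma sub_mod_inj (N x y z : nat) :
  x < N -> y < N -> z < N -> sub_mod N y x = sub_mod N z x -> y = z.
Proof. by rewrite /sub_mod; case: (leqP x y); case: (leqP x z); lia. Qed.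

(** With [d = y - x], the numbers [d] and [2 h - d] have the same parity and lie on opposite sides
    of [h], so exactly one of them gets the shift by [h]; moreover [d + (2 h - d)./2 = d./2 + h]. *)
Lemma delta_sub_mod (h x y : nat) :
  x < h.*2 -> y < h.*2 -> x != y -> sub_mod h.*2 y x != h ->
  (x + delta h (sub_mod h.*2 y x)) %% h.*2 =
  (y + delta h (sub_mod h.*2 x y)) %% h.*2.
Proof.
wlog lt_xy : x y / x < y.
  move=> IH lt_x lt_y nxy nh; have [lt_xy|lt_yx] : x < y \/ y < x by lia.
    exact: IH.
  apply/esym; apply: IH => //; first by rewrite eq_sym.
  move: nh; rewrite /sub_mod (ltnW lt_yx) leqNgt lt_yx /=; lia.
rewrite /sub_mod.
move=> lt_x lt_y _; rewrite (ltnW lt_xy) leqNgt lt_xy /=.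
have : 0 < y - x < h.*2 by lia.
have -> : x + h.*2 - y = h.*2 - (y - x) by lia.
move: (y - x) (subnKC (ltnW lt_xy)) => d <- dP nh; rewrite -addnA; apply/eqP; rewrite eqn_modDl; apply/eqP.
rewrite /delta oddB; last lia.
rewrite odd_double /= (negbTE nh).
have -> : (h.*2 - d == h) = false by lia.
have -> : (h < h.*2 - d) = ~~ (h < d) by lia.
have := odd_double_half d.
case: (odd d); case: (ltnP h d) => lt_hd /=; rewrite ?muln0 ?muln1 ?addn0 => dE.
- have -> : d + ((h.*2 - d)./2 + h) = d./2 + h.*2 by lia.
  by rewrite modnDr.
- by have -> : d + (h.*2 - d)./2 = d./2 + h by lia.
- by have -> : d + (h.*2 - d)./2 = d./2 + h by lia.
- have -> : d + ((h.*2 - d)./2 + h) = d./2 + h.*2 by lia.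
  by rewrite modnDr.
Qed.

(** The complete multipartite graph with [2 s + 1] parts of size [q]: the residue classes mod [2 s]
    on the left, and the whole right summand. *)
Definition equipartite (s q : nat) : rel ('I_(s.*2 * q) + 'I_q)%type := fun a b =>
  match a, b with
  | inl x, inl y => x != y %[mod s.*2]
  | inr _, inr _ => false
  | _, _ => true
  end.

(* The vertex [inr u] uses the shift [delta h d] for the [u]-th multiple [d] of
   [s.*2], with [h] in place of [0] because [delta h 0] gives the vertex color. *)
Definition equipartite_col (s q : nat) (a b : 'I_(s.*2 * q) + 'I_q) : nat :=
  let h := s * q in
  let slot (u : nat) := if u == 0 then h else s.*2 * u in
  match a, b with
  | inl x, inl y =>
      let d := sub_mod h.*2 y x in
      if d == h then h.*2 else (x + delta h d) %% h.*2
  | inl x, inr u | inr u, inl x => (x + delta h (slot u)) %% h.*2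
  | inr _, inr _ => h.*2
  end.

(** In row [inl x] the vertex, its left neighbors and the right part use pairwise distinct shifts,
    the antipode taking the extra color [2 h]; in row [inr u] the shift is constant and [x]
    varies. *)
Lemma equipartite_total_colorable (s q : nat) :
  0 < s -> odd q -> total_colorable (@equipartite s q) (s.*2 * q).+1.
Proof.
move=> s_gt0 odd_q; have q_gt0 : 0 < q by case: q odd_q.
have h_gt0 : 0 < s * q by rewrite muln_gt0 s_gt0.
have Nh : s.*2 * q = (s * q).*2 by rewrite doubleMl.
have lt_N (x : 'I_(s.*2 * q)) : x < (s * q).*2 by rewrite -Nh.
have slot_lt (u : 'I_q) : (if u == 0 :> nat then s * q else s.*2 * u) < (s * q).*2.
  case: eqP => [_|_]; first lia.
  by rewrite -Nh ltn_mul2l double_gt0 s_gt0 ltn_ord.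
have sub_lt x y : x < (s * q).*2 -> y < (s * q).*2 -> sub_mod (s * q).*2 y x < (s * q).*2.
  by move=> lx ly; rewrite /sub_mod; case: (leqP x y); lia.
have step x d d' : d < (s * q).*2 -> d' < (s * q).*2 ->
    (x + delta (s * q) d) %% (s * q).*2 = (x + delta (s * q) d') %% (s * q).*2 -> d = d'.
  move=> ld ld' /eqP; rewrite eqn_modDl !modn_small ?delta_lt // => /eqP.
  exact: delta_inj.
have neN x : (x %% (s * q).*2 == (s * q).*2) = false.
  by apply/negbTE; rewrite neq_ltn ltn_mod double_gt0 h_gt0.
(* Inside the left side a difference is [0] or not a multiple of [2 s], whereas a slot other than
   [h] is a nonzero multiple of [2 s]. *)
have slotN x y (u : 'I_q) : x < (s * q).*2 -> y < (s * q).*2 ->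
    (x == y) || (x != y %[mod s.*2]) -> sub_mod (s * q).*2 y x <> s * q ->
    sub_mod (s * q).*2 y x <> (if u == 0 :> nat then s * q else s.*2 * u).
  move=> lx ly xy nh; case: eqP => [//|/eqP u0].
  have su : 0 < s.*2 * u by rewrite muln_gt0 double_gt0 s_gt0 lt0n.
  case/orP: xy => [/eqP->|]; first by rewrite /sub_mod leqnn subnn; lia.
  move=> /negP nxy E; apply: nxy.
  move: E; rewrite /sub_mod; case: (leqP x y) => lxy E.
    have -> : y = s.*2 * u + x by lia.
    by rewrite mulnC modnMDl.
  have : y + s.*2 * q = s.*2 * u + x by lia.
  rewrite ![s.*2 * _]mulnC addnC => /(congr1 (modn^~ s.*2)).
  by rewrite !modnMDl => ->.
apply: (@total_colorable_of_array _ _ _ _ _ (@equipartite_col s q) (iota 0 (s * q).*2.+1)).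
- by case=> [x|u] [y|v] //=; rewrite eq_sym.
- by case=> [x|u] //=; rewrite eqxx.
- case=> [x|u] [y|v] //= nxy.
  have xy : x != y :> nat by apply: contraNneq nxy => ->.
  (* Being antipodal is symmetric, as [h = - h] mod [2 h]. *)
  have -> : (sub_mod (s * q).*2 x y == s * q) = (sub_mod (s * q).*2 y x == s * q).
    by have := lt_N x; have := lt_N y; rewrite /sub_mod; case: (ltngtP x y) => //; lia.
  by case: eqP => // /eqP; apply: delta_sub_mod.
- have inlE (x y : 'I_(s.*2 * q)) : (inl 'I_q x == inl y) = (x == y :> nat) by [].
  case=> [x|u] [y|v] [z|w] //; rewrite ?inlE /=.
  + move=> xy xz; case: eqP => [Ey|ny]; case: eqP => [Ez|nz].
    * move=> _; congr inl; apply: val_inj => /=.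
      by apply: (@sub_mod_inj (s * q).*2 x); rewrite ?lt_N // Ey Ez.
    * by move/esym/eqP; rewrite neN.
    * by move/eqP; rewrite neN.
    * move/step => E; have {E} := E (sub_lt _ _ (lt_N _) (lt_N _)) (sub_lt _ _ (lt_N _) (lt_N _)).
      move=> E; congr inl; apply: val_inj => /=.
      exact: sub_mod_inj E.
  + move=> xy _; case: eqP => [_ /esym/eqP|ny]; first by rewrite neN.
    by move/step => E; case: (slotN x y w) => //; apply: E => //; apply: sub_lt.
  + move=> _ xz; case: (sub_mod _ z x =P _) => [_ /eqP|nz]; first by rewrite neN.
    by move/step => E; case: (slotN x z v) => //; apply/esym; apply: E => //; apply: sub_lt.
  + move=> _ _ /step => E; have {E} := E (slot_lt v) (slot_lt w).
    (* Here [q] odd matters: [h] is an odd multiple of [s], so it coincides with no other slot. *)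
    have parity t : s * q <> s.*2 * t.
      move=> E; have /eqP : s * q = s * t.*2 by rewrite E; lia.
      rewrite eqn_mul2l eqn0Ngt s_gt0 /= => /eqP qE.
      by rewrite qE odd_double in odd_q.
    case: eqP => [v0|/eqP v0]; case: eqP => [w0|/eqP w0].
    * by move=> _; congr inr; apply: val_inj; rewrite /= v0 w0.
    * by move/parity.
    * by move/esym/parity.
    * move=> /eqP; rewrite eqn_mul2l double_eq0 eqn0Ngt s_gt0 /= => /eqP E.
      by congr inr; apply: val_inj.
  + move=> _ _ /eqP; rewrite eqn_modDr !modn_small // => /eqP E.
    by congr inl; apply: val_inj.
  + by move=> _ _ /eqP; rewrite neN.
  + by move=> _ _ /esym/eqP; rewrite neN.
  + by rewrite !orbF => /eqP<- /eqP<-.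
(* As [delta h 0 = 0], a left vertex is its own color, which is less than the color [2 h] of the
   right vertices. *)
- have diag (x : 'I_(s.*2 * q)) : equipartite_col s q (inl x) (inl x) = x.
    rewrite /= /sub_mod leqnn subnn /delta eq_sym eqn0Ngt h_gt0 /=.
    by rewrite muln0 !addn0 modn_small ?lt_N.
  case=> [x|u] [y|v]; rewrite ?diag //.
  + by move=> /= nxy E; rewrite E eqxx in nxy.
  + by move=> _ /= E; have := lt_N x; rewrite E ltnn.
  + by move=> _ /= E; have := lt_N y; rewrite E ltnn.
- have lt_mod x : x %% (s * q).*2 < (s * q).*2.+1.
    by rewrite ltnS ltnW // ltn_mod double_gt0.
  move=> a b _; rewrite mem_iota add0n leq0n /=.
  by case: a b => [x|u] [y|v] /=; rewrite ?lt_mod //; case: ifP.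
- by rewrite size_iota Nh.
Qed.

(** * Unitary Cayley graphs: degrees and residues of adjacent vertices *)

Lemma unitary_cayleyE (n d : nat) (x y : 'I_n) :
  y = x + d %[mod n] -> unitary_cayley x y = coprime d n.
Proof.
move=> E; rewrite unitary_cayley_sym /unitary_cayley /coprimez -gcdz_modl.
have -> : ((y%:Z - x%:Z) %% n%:Z = d%:Z %% n%:Z)%Z.
  apply/eqP; rewrite eqz_mod_dvd.
  have -> : (y%:Z - x%:Z - d%:Z = y%:Z - (x + d)%:Z)%R by lia.
  by rewrite -eqz_mod_dvd !modz_nat E.
by rewrite gcdz_modl.
Qed.

(** Translation by [- x], written [y + (n - x)] to stay in [nat], carries the neighbors of [x] onto
    the residues prime to [n]. *)
Lemma degree_unitary_cayley (n : nat) (x : 'I_n) :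
  degree (@unitary_cayley n) x = totient n.
Proof.
have n_gt0 : 0 < n by case: n x => [[]|].
rewrite totient_count_coprime big_mkord /degree -sum1_card big_mkcond /=.
pose f (y : 'I_n) : 'I_n := Ordinal (ltn_pmod (y + (n - x)) n_gt0).
have f_inj : injective f.
  by move=> y z /(congr1 (@nat_of_ord n))/eqP; rewrite /= eqn_modDr !modn_small // => /eqP/val_inj.
rewrite [RHS](reindex_inj f_inj) /=; apply: eq_bigr => y _.
rewrite inE (@unitary_cayleyE _ ((y + (n - x)) %% n)) 1?coprime_sym; first by case: coprime.
by rewrite modnDmr addnCA subnKC ?modnDr // ltnW.
Qed.

Lemma max_degree_unitary_cayley (n : nat) : max_degree (@unitary_cayley n) = totient n.
Proof.
rewrite /max_degree; under eq_bigr do rewrite degree_unitary_cayley.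
case: n => [|n]; first by rewrite big_ord0.
by rewrite big_const_ord; move: (totient _) => t; elim: n => [|n IHn]; rewrite iterS ?maxn0 ?IHn ?maxnn.
Qed.

(** Serves for the parts mod [p], for the bipartition by parity, and for the vertex colors mod
    [pdiv m]. *)
Lemma unitary_cayley_neq_mod (n d : nat) (x y : 'I_n) :
  1 < d -> d %| n -> unitary_cayley x y -> x != y %[mod d].
Proof.
move=> d_gt1 dn; rewrite /unitary_cayley => /(coprimez_dvdr dn).
apply: contraTneq => xy; have : (x%:Z - y%:Z)%R \in dvdz d%:Z.
  by rewrite -eqz_mod_dvd !modz_nat xy.
move=> /gcdz_idPr; rewrite /coprimez => ->; lia.
Qed.

(** A common prime factor would be at most [i], hence below the least prime factor of [m]. *)
Lemma pdiv_coprime (m i : nat) : 0 < i < pdiv m -> coprime i m.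
Proof.
case/andP=> i_gt0 lt_i; rewrite coprime_has_primes //; last first.
  by case: m lt_i => // /(leq_ltn_trans i_gt0).
apply/hasPn => r /=; rewrite !mem_primes => /and3P[r_pr _ r_m].
apply/negP => /and3P[_ _ /(dvdn_leq i_gt0) r_i].
have := pdiv_min_dvd (prime_gt1 r_pr) r_m; lia.
Qed.

(** * Odd prime powers *)

Lemma total_colorable_unitary_cayley_prime_power (p k : nat) :
  prime p -> odd p -> total_colorable (@unitary_cayley (p ^ k.+1)) (totient (p ^ k.+1)).+1.
Proof.
move=> p_pr p_odd; have p_gt1 := prime_gt1 p_pr; have p_gt0 := prime_gt0 p_pr.
rewrite totient_pfactor //=; set q := p ^ k.
have q_odd : odd q by rewrite oddX p_odd orbT.
have pE : p.-1 = (p./2).*2 by lia.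
have s_gt0 : 0 < p./2 by lia.
rewrite pE.
have div_lt (x : 'I_(p ^ k.+1)) : x %/ p < q.
  by rewrite ltn_divLR // /q -expnSr.
have mod_lt (x : nat) : (x %% p).-1 < (p./2).*2.
  by have := ltn_pmod x p_gt0; lia.
have pos_lt (x : 'I_(p ^ k.+1)) : x %/ p * (p./2).*2 + (x %% p).-1 < (p./2).*2 * q.
  rewrite mulnC; apply: leq_trans (_ : (p./2).*2 * (x %/ p).+1 <= _).
    by rewrite mulnS addnC ltn_add2r.
  by rewrite leq_pmul2l ?double_gt0.
(* Multiples of [p] form the right part, indexed by their quotient; a residue [r > 0] mod [p]
   becomes [r - 1] mod [p - 1], with the same quotient. *)
pose f (x : 'I_(p ^ k.+1)) : ('I_((p./2).*2 * q) + 'I_q)%type :=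
  if x %% p == 0 then inr (Ordinal (div_lt x)) else inl (Ordinal (pos_lt x)).
apply: (@total_colorable_pullback _ _ _ (@equipartite p./2 q) f).
- have eq_divmod (x y : 'I_(p ^ k.+1)) : x %/ p = y %/ p -> x %% p = y %% p -> x = y.
    by move=> ed em; apply: val_inj; rewrite /= (divn_eq x p) ed em -divn_eq.
  move=> x y; rewrite /f; case: eqP => [x0|/eqP x0]; case: eqP => [y0|/eqP y0] //.
    by case=> ed; apply: eq_divmod => //; rewrite x0 y0.
  case=> E; have em : (x %% p).-1 = (y %% p).-1.
    by have := congr1 (modn^~ (p./2).*2) E; rewrite /= !modnMDl !(modn_small (mod_lt _)).
  apply: eq_divmod; last by move: x0 y0 em; lia.
  move: E => /eqP; rewrite em eqn_add2r eqn_mul2r double_eq0 eqn0Ngt s_gt0 /=.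
  by move/eqP.
- have p_n : p %| p ^ k.+1 by rewrite expnS dvdn_mulr.
  move=> x y /(unitary_cayley_neq_mod _ _ _ _ p_gt1 p_n) nxy.
  rewrite /f; case: eqP => [x0|/eqP x0]; case: eqP => [y0|/eqP y0] //=.
    by rewrite x0 y0 eqxx in nxy.
  by rewrite !modnMDl !(modn_small (mod_lt _)); apply: contraNN nxy => /eqP; move: x0 y0; lia.
- exact: equipartite_total_colorable.
Qed.

(** * Even orders with a nontrivial odd factor *)

(* The [i] such that [y = x + m + 2 i] mod [n]. *)
Definition half_gap (n m x y : nat) : nat := ((y + (n - x) + (n - m)) %% n)./2.

(** The number [y - x - m] is even and stays so after reduction mod the even [n], so halving loses
    nothing. *)
Lemma half_gapP (n m x y : nat) :
  ~~ odd n -> odd m -> ~~ odd x -> odd y -> x < n -> m < n ->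
  x + m + (half_gap n m x y).*2 = y %[mod n] /\ (half_gap n m x y).*2 < n.
Proof.
move=> n_even m_odd x_even y_odd lt_xn lt_mn; rewrite /half_gap even_halfK; last first.
  rewrite odd_mod ?(negbTE n_even) // !oddD !oddB 1?ltnW //.
  by rewrite m_odd y_odd (negbTE n_even) (negbTE x_even).
split; last by rewrite ltn_mod (leq_ltn_trans _ lt_xn).
rewrite modnDmr; have -> : x + m + (y + (n - x) + (n - m)) = y + n + n by lia.
by rewrite !modnDr.
Qed.

(** The index is read from the even end of the edge, which makes it symmetric; [0] is reserved for
    the vertices. *)
Definition even_slot (n m x y : nat) : nat :=
  if x == y then 0 else if odd x then half_gap n m y x else half_gap n m x y.

Definition even_col (n m x y : nat) : nat :=
  let i := even_slot n m x y in
  if i < pdiv m then ((if odd x then y else x) + i) %% pdiv m else i.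

Lemma coprime_pow2_mul (k m d : nat) :
  coprime d (2 ^ k.+1 * m) = odd d && coprime d m.
Proof. by rewrite coprimeMr coprime_pexpr // coprimen2. Qed.

(** The map sending [c] to [m + 2 c] mod [n] is injective for [c < n / 2]; it sends [0] to [m],
    which accounts for the successor, and the other colors to residues prime to [n]. *)
Lemma size_even_colors (k m : nat) : 1 < m -> odd m ->
  size [seq c <- iota 0 (2 ^ k * m) | (c < pdiv m) || coprime c m]
    <= (totient (2 ^ k.+1 * m)).+1.
Proof.
move=> m_gt1 m_odd; set h := 2 ^ k * m; set n := 2 ^ k.+1 * m.
have nE : n = h.*2 by rewrite /n /h expnS -mulnA mul2n.
have le_mh : m <= h by rewrite leq_pmull // expn_gt0.
have m_gt0 := ltnW m_gt1.
pose g c := (m + c.*2) %% n.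
set s := filter _ _.
rewrite -(size_map g) totient_count_coprime.
have -> : (\sum_(0 <= d < n) coprime n d).+1 =
          size (m :: [seq d <- iota 0 n | coprime n d]).
  by rewrite /= size_filter -sum1_count [in RHS]big_mkcond /index_iota subn0.
apply: uniq_leq_size.
  rewrite map_inj_in_uniq ?filter_uniq ?iota_uniq // => c d.
  rewrite !mem_filter !mem_iota !add0n /= => /andP[_ lc] /andP[_ ld] /eqP.
  by rewrite /g eqn_modDl !modn_small ?nE ?ltn_double // => /eqP/double_inj.
move=> _ /mapP[c + ->]; rewrite mem_filter => /andP[cP _].
have [->|c_gt0] := posnP c.
  by rewrite /g addn0 modn_small ?inE ?eqxx // nE; lia.
rewrite inE mem_filter mem_iota add0n /= ltn_mod; apply/orP; right.
rewrite nE double_gt0 (leq_trans m_gt0) // andbT -nE coprime_sym coprime_modl.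
rewrite coprime_pow2_mul oddD odd_double addbF m_odd.
rewrite -coprime_modl modnDl coprime_modl -muln2 coprimeMl coprime2n m_odd andbT /=.
by case/orP: cP => // lt_c; apply: pdiv_coprime; rewrite c_gt0.
Qed.

(** For fixed even [x] the colors [x + i] with [i < p] are distinct mod [p]; from the odd end
    [y = x + m + 2 i] the same color reads [y - i] mod [p], since [p] divides [m], so these are
    distinct too. *)
Lemma total_colorable_unitary_cayley_even (k m : nat) : 1 < m -> odd m ->
  total_colorable (@unitary_cayley (2 ^ k.+1 * m)) (totient (2 ^ k.+1 * m)).+1.
Proof.
move=> m_gt1 m_odd; set n := 2 ^ k.+1 * m; set h := 2 ^ k * m.
have nE : n = h.*2 by rewrite /n /h expnS -mulnA mul2n.
have le_mh : m <= h by rewrite leq_pmull // expn_gt0.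
have n_even : ~~ odd n by rewrite nE odd_double.
have lt_mn : m < n by rewrite nE; lia.
have n_gt1 : 1 < n by apply: leq_trans lt_mn; rewrite ltnW.
have p_pr := pdiv_prime m_gt1; have p_m := pdiv_dvd m.
have p_gt1 := prime_gt1 p_pr; have p_gt0 := prime_gt0 p_pr.
have m_n : m %| n by rewrite dvdn_mull.
have p_n : pdiv m %| n by apply: dvdn_trans m_n.
have le_ph : pdiv m <= h by apply: leq_trans le_mh; rewrite dvdn_leq // ltnW.
have sym := @unitary_cayley_sym n; have irr := unitary_cayley_irrefl n_gt1.
set p := pdiv m in p_pr p_m p_gt1 p_gt0 p_n le_ph *.
have adj_odd (x y : 'I_n) : unitary_cayley x y -> odd y = ~~ odd x.
  have two_n : 2 %| n by rewrite dvdn2.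
  move=> /(unitary_cayley_neq_mod _ 2 _ _ isT two_n).
  by rewrite !modn2; case: (odd x); case: (odd y).
have adj_modp (x y : 'I_n) : unitary_cayley x y -> x != y %[mod p].
  exact: unitary_cayley_neq_mod.
have adj_neq (x y : 'I_n) : unitary_cayley x y -> (x == y :> nat) = false.
  by move=> exy; apply/eqP => xy; have := adj_odd _ _ exy; rewrite xy; case: odd.
have slot_sym (x y : 'I_n) : unitary_cayley x y -> even_slot n m x y = even_slot n m y x.
  by move=> exy; rewrite /even_slot eq_sym (adj_odd _ _ exy) if_neg.
have slotP (x y : 'I_n) : unitary_cayley x y -> ~~ odd x ->
    x + m + (even_slot n m x y).*2 = y %[mod n] /\ even_slot n m x y < h.
  move=> exy x_even; rewrite -ltn_double -nE /even_slot adj_neq // (negbTE x_even).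
  by apply: half_gapP; rewrite ?(adj_odd _ _ exy).
have slot_oddP (x y : 'I_n) : unitary_cayley x y -> odd x ->
    y + m + (even_slot n m x y).*2 = x %[mod n] /\ even_slot n m x y < h.
  move=> exy x_odd; rewrite slot_sym //; apply: slotP; first by rewrite sym.
  by rewrite (adj_odd _ _ exy) x_odd.
have slot_coprime (x y : 'I_n) : unitary_cayley x y -> coprime (even_slot n m x y) m.
  wlog x_even : x y / ~~ odd x.
    move=> IH exy; have [x_odd|] := boolP (odd x); last by move=> ?; apply: IH.
    by rewrite slot_sym //; apply: IH; rewrite ?(adj_odd _ _ exy) ?x_odd // sym.
  move=> exy; have [E _] := slotP _ _ exy x_even.
  move: exy; rewrite (@unitary_cayleyE n (m + (even_slot n m x y).*2)) ?addnA //.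
  rewrite coprime_pow2_mul -(coprime_modl (m + _)) modnDl coprime_modl.
  by rewrite -muln2 coprimeMl => /and3P[].
(* Index [0] is free for the vertices because [0] is not prime to [m > 1]. *)
have slot_gt0 (x y : 'I_n) : unitary_cayley x y -> 0 < even_slot n m x y.
  move/slot_coprime; case: posnP => // ->; rewrite /coprime gcd0n; lia.
have slot_lt (x y : 'I_n) : unitary_cayley x y -> even_slot n m x y < h.
  by move=> exy; have [/(slot_oddP _ _ exy)[]|/(slotP _ _ exy)[]] := boolP (odd x).
have slotxx x : even_slot n m x x = 0 by rewrite /even_slot eqxx.
have modp a b : a = b %[mod n] -> a = b %[mod p].
  by move=> E; rewrite -(modn_dvdm a p_n) E modn_dvdm.
have slot_modp (x y : 'I_n) : (x == y) || unitary_cayley x y -> odd x ->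
    y + (even_slot n m x y).*2 = x %[mod p].
  case/orP=> [/eqP->|exy x_odd]; first by rewrite slotxx addn0.
  have [/modp <- _] := slot_oddP _ _ exy x_odd.
  by rewrite addnAC -(modnDmr _ m) (eqP p_m) addn0.
have slot_inj (x y z : 'I_n) : (x == y) || unitary_cayley x y ->
    (x == z) || unitary_cayley x z -> even_slot n m x y = even_slot n m x z -> y = z.
  case/orP=> [/eqP<-|exy]; case/orP=> [/eqP<-|exz] //; rewrite ?slotxx.
  - by move=> E; have := slot_gt0 _ _ exz; rewrite -E.
  - by move=> E; have := slot_gt0 _ _ exy; rewrite E.
  have [x_odd|x_even] := boolP (odd x); last first.
    have [Ey _] := slotP _ _ exy x_even; have [Ez _] := slotP _ _ exz x_even.
    by move=> E; apply: val_inj; move: Ey; rewrite E Ez !modn_small // => ->.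
  have [Ey _] := slot_oddP _ _ exy x_odd; have [Ez _] := slot_oddP _ _ exz x_odd.
  move=> E; apply: val_inj; move/eqP: Ey; rewrite -Ez E !eqn_modDr !modn_small //.
  by move/eqP.
(* A color is below [p] exactly when its index is, so the two kinds of colors never meet. *)
have lt_slot_p (x y z : 'I_n) : even_col n m x y = even_col n m x z ->
    (even_slot n m x y < p) = (even_slot n m x z < p).
  rewrite /even_col -/p; case: (ltnP (even_slot n m x y) p) => ly; case: (ltnP (even_slot n m x z) p) => lz //.
    by move=> E; rewrite -E leqNgt ltn_mod p_gt0 in lz.
  by move=> E; rewrite E leqNgt ltn_mod p_gt0 in ly.
apply: (@total_colorable_of_array _ _ sym irr _ (fun x y => even_col n m x y)
         [seq c <- iota 0 h | (c < p) || coprime c m]).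
- move=> x y exy; rewrite /even_col (slot_sym _ _ exy) (adj_odd _ _ exy).
  by case: (odd x).
- move=> x y z exy exz E; apply: (slot_inj x) => //.
  have := lt_slot_p _ _ _ E; move: E; rewrite /even_col -/p.
  case: (ltnP (even_slot n m x y) p) => ly; case: (ltnP (even_slot n m x z) p) => lz // + _.
  have [x_odd|x_even] := boolP (odd x); last first.
    by move=> /eqP; rewrite eqn_modDl !modn_small // => /eqP.
  (* At an odd [x], with [i] and [j] the indices to [y] and [z], both [y + 2 i = z + 2 j] and
     [y + i = z + j] hold mod [p]; subtracting gives [i = j]. *)
  have := slot_modp _ _ exy x_odd; rewrite -(slot_modp _ _ exz x_odd).
  rewrite -!addnn !addnA => E1 E2.
  move/eqP: E1; rewrite -modnDml E2 modnDml eqn_modDl !modn_small //.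
  by move/eqP.
- by move=> x y /adj_modp; rewrite /even_col !slotxx p_gt0 !addn0 !if_same => /eqP.
- move=> x y exy; rewrite mem_filter mem_iota add0n leq0n /= /even_col -/p.
  have [_|] := ltnP (even_slot n m x y) p.
    by rewrite ltn_mod p_gt0 (leq_trans _ le_ph) // ltn_mod.
  case/orP: exy => [/eqP<-|exy _]; first by rewrite slotxx leqNgt p_gt0.
  by rewrite slot_coprime // slot_lt // orbT.
- exact: size_even_colors.
Qed.

Theorem theorem2p2 (n : nat)
  (hn : (exists k m : nat, [/\ 0 < k, 1 < m, odd m & n = 2 ^ k * m]) \/
        (exists p k : nat, [/\ prime p, odd p, 0 < k & n = p ^ k])) :
  max_degree (@unitary_cayley n) = totient n /\
  total_colorable (@unitary_cayley n) (max_degree (@unitary_cayley n)).+1.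
Proof.
split; first exact: max_degree_unitary_cayley.
rewrite max_degree_unitary_cayley.
case: hn => [[[|k] [m [// _ m_gt1 m_odd ->]]]|[p [[|k] [// p_pr p_odd _ ->]]]].
  exact: total_colorable_unitary_cayley_even.
exact: total_colorable_unitary_cayley_prime_power.
Qed.
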